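(* For all integers $n\ge 2$ and $d_1,\ldots,d_n\ge 2$, \[ \max\bigl\{\dim\mathcal{L} : \mathcal{L}\text{ is a subspace of }\mathcal{H}(d_1,\ldots,d_n)\text{ and has no product basis}\bigr\} = \tilde{d}-2, \] where $\mathcal{H}(d_1,\ldots,d_n)=\mathbb{C}^{d_1}\otimes\cdots\otimes\mathbb{C}^{d_n}$ and $\tilde{d}=d_1d_2\cdots d_n$.
   Context: A vector $u\in\mathbb{C}^{d_1}\otimes\cdots\otimes\mathbb{C}^{d_n}$ is called a product vector if $u=u^{[1]}\otimes\cdots\otimes u^{[n]}$ for some $u^{[1]}\in\mathbb{C}^{d_1},\ldots,u^{[n]}\in\mathbb{C}^{d_n}$. A product basis of a subspace $\mathcal{L}$ is a basis of $\mathcal{L}$ composed of product vectors (no orthogonality is required). *)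

(* Defs.v *)
From HB Require Import structures.
From mathcomp Require Import all_boot all_order all_algebra.
From mathcomp Require Import reals complex.

Set Implicit Arguments.
Unset Strict Implicit.
Unset Printing Implicit Defensive.

Import GRing.Theory.
Local Open Scope ring_scope.

(* C^{d_0} (x) ... (x) C^{d_(n-1)} in coordinates: a tensor is the array of its
   coefficients on the product basis e_{x_0} (x) ... (x) e_{x_(n-1)}, indexed by
   the tuples x with x i < d i.  [R[i]^o] is the field R[i] as a vector space
   over itself. *)
Definition multi_index (n : nat) (d : 'I_n -> nat) : finType :=
  {dffun forall i : 'I_n, 'I_(d i)}.

Definition tensor_space (R : realType) (n : nat) (d : 'I_n -> nat)
    : vectType R[i] :=
  {ffun multi_index d -> R[i]^o}.

Definition pure_tensor (R : realType) (n : nat) (d : 'I_n -> nat)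
    (u : forall i : 'I_n, 'rV[R[i]]_(d i)) : tensor_space R d :=
  [ffun x : multi_index d => (\prod_(i < n) u i 0 (x i) : R[i]^o)].

Definition product_vector (R : realType) (n : nat) (d : 'I_n -> nat)
    (v : tensor_space R d) : Prop :=
  exists u : forall i : 'I_n, 'rV[R[i]]_(d i), v = pure_tensor u.

(* The zero subspace has the empty product basis. *)
Definition has_product_basis (R : realType) (n : nat) (d : 'I_n -> nat)
    (L : {vspace tensor_space R d}) : Prop :=
  exists s : seq (tensor_space R d),
    basis_of L s /\ (forall v, v \in s -> product_vector v).

Definition is_maximum (S : nat -> Prop) (m : nat) : Prop :=
  S m /\ (forall k, S k -> (k <= m)%N).

(* Main.v *)
(* If [f <> 0] and [g] are linear functionals such that [g] vanishes at every
   product vector where [f] does, then [g] is a multiple of [f]; hence the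
   product vectors of a hyperplane span it, and a maximal free family of them is
   a basis. In codimension two, a product vector with [v_11 = 0] and
   [v_01 = v_10] (all other slots at 0) satisfies [v_10 ^ 2 = v_11 * v_00 = 0],
   so that the product vectors of that subspace lie in a proper subspace. *)
Require Import Defs.
From HB Require Import structures.
From mathcomp Require Import all_boot all_order all_algebra.
From mathcomp Require Import boolp reals complex.

Set Implicit Arguments.
Unset Strict Implicit.
Unset Printing Implicit Defensive.

Import GRing.Theory.
Local Open Scope ring_scope.

(** * Functionals, hyperplanes and bases *)

Lemma linear_linfun (K : fieldType) (aT rT : vectType K) (h : aT -> rT) :
  linear h -> forall v, linfun h v = h v.
Proof.
move=> h_lin; pose hL := GRing.isLinear.Build _ _ _ _ h h_lin.
pose H : {linear aT -> rT} := HB.pack h hL.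
exact: (lfunE H).
Qed.

(** Some coordinate of [v - projv U v] is nonzero; that coordinate composed with [\1 - projv U],
    which kills [U], is the functional. *)
Lemma separating_functional (K : fieldType) (vT : vectType K)
    (U : {vspace vT}) (v : vT) :
  v \notin U -> exists2 f : 'Hom(vT, K^o), (U <= lker f)%VS & f v != 0.
Proof.
move=> vU; set w := v - projv U v.
have w_neq0 : w != 0.
  by apply: contraNneq vU => /subr0_eq ->; apply: memv_proj.
have [i wi] : exists i, coord (vbasis {:vT}) i w != 0.
  apply/existsP; apply: contra_neqT w_neq0 => /existsPn w0.
  rewrite (coord_vbasis (memvf w)) big1 // => i _.
  by move/negbNE/eqP: (w0 i) => ->; rewrite scale0r.
pose c (u : vT) : K^o := coord (vbasis {:vT}) i u.
have cE : linfun c =1 c.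
  by apply: linear_linfun => a u1 u2; rewrite /c linearP.
exists (linfun c \o (\1 - projv U))%VF.
  apply/subvP => u uU.
  rewrite memv_ker comp_lfunE add_lfunE opp_lfunE id_lfunE projv_id //.
  by rewrite subrr linear0.
by rewrite comp_lfunE add_lfunE opp_lfunE id_lfunE cE.
Qed.

(** If [L] is proper, a functional separating some vector from [L] has a proper kernel containing
    [L], and the dimensions force equality. *)
Lemma codim_le1_lker (K : fieldType) (vT : vectType K) (L : {vspace vT}) :
  (dim vT <= (\dim L).+1)%N -> exists f : 'Hom(vT, K^o), L = lker f.
Proof.
move=> dimL; have [LT|/negP] := boolP ({:vT} <= L)%VS.
  exists 0; apply/vspaceP => v.
  by rewrite memv_ker lfunE eqxx; apply: (subvP LT); apply: memvf.
move=> LT; have [v vL] : exists v, v \notin L.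
  by apply/not_existsP => vL; apply/LT/subvP => v _; apply/negPn/negP/vL.
have [f Lf fv] := separating_functional vL.
exists f; apply/eqP; rewrite eqEdim Lf /= -ltnS (leq_trans _ dimL) //.
have: (\dim (lker f) < \dim {:vT})%N.
  rewrite ltnNge; apply: contra fv => dimf; rewrite -memv_ker.
  have /eqP -> : (lker f == fullv)%VS by rewrite eqEdim subvf.
  exact: memvf.
by rewrite dimvf.
Qed.

(** The hypothesis says that the vectors of [L] with [P] span [L]. While a free family of them does
    not span [L], one of them lies outside its span and extends it. *)
Lemma basis_of_spanning (K : fieldType) (vT : vectType K) (L : {vspace vT})
    (P : vT -> Prop) :
  (forall U : {vspace vT},
     (forall v, P v -> v \in L -> v \in U) -> (L <= U)%VS) ->
  exists s : seq vT, basis_of L s /\ (forall v, v \in s -> P v).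
Proof.
move=> spanP.
(* [k] bounds the number of vectors still missing. *)
suff ext k : forall s : seq vT, free s -> (<<s>> <= L)%VS ->
    (forall v, v \in s -> P v) -> (\dim L - size s <= k)%N ->
    exists s : seq vT, basis_of L s /\ (forall v, v \in s -> P v).
  by apply: (ext _ [::]) (leqnn _) => //; rewrite ?nil_free // span_nil sub0v.
elim: k => [|k IHk] s frs sL sP szs.
  by exists s; split=> //; rewrite basisEfree frs sL -subn_eq0 -leqn0.
have [Ls|/negP] := boolP (L <= <<s>>)%VS.
  by exists s; rewrite basisEdim Ls -(eqnP frs) dimvS.
move=> nLs.
have [v [Pv vL vs]] : exists v, [/\ P v, v \in L & v \notin <<s>>%VS].
  apply/not_existsP => nv; apply/nLs/spanP => v Pv vL.
  by apply/negPn/negP => vs; apply: (nv v).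
apply: (IHk (v :: s)).
- by rewrite free_cons vs.
- by rewrite span_cons subv_add sL memvE in vL *; rewrite vL.
- by move=> u /[!inE] /predU1P[->|/sP].
- by rewrite /= subnS -subn1 leq_subLR.
Qed.

(** * Pure tensors and their multilinearity *)

Lemma pure_tensor_eq (R : realType) (n : nat) (d : 'I_n -> nat)
    (u v : forall i : 'I_n, 'rV[R[i]]_(d i)) :
  (forall i, u i = v i) -> pure_tensor u = pure_tensor v.
Proof.
by move=> uv; apply/ffunP => x; rewrite !ffunE; apply: eq_bigr => i; rewrite uv.
Qed.

Lemma pure_tensor_dfwithP (R : realType) (n : nat) (d : 'I_n -> nat)
    (u : forall i : 'I_n, 'rV[R[i]]_(d i)) (i : 'I_n) (a : R[i])
    (w w' : 'rV[R[i]]_(d i)) :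
  pure_tensor (dfwith u (a *: w + w')) =
  a *: pure_tensor (dfwith u w) + pure_tensor (dfwith u w').
Proof.
apply/ffunP => x; rewrite !ffunE.
have E z : \prod_(j < n) dfwith u z j 0 (x j) =
           z 0 (x i) * \prod_(j < n | j != i) u j 0 (x j).
  rewrite (bigD1 i) //= dfwith_in; congr (_ * _).
  by apply: eq_bigr => j ji; rewrite dfwith_out // eq_sym.
by rewrite !E !mxE mulrDl -mulrA.
Qed.

Lemma pure_tensor_delta (R : realType) (n : nat) (d : 'I_n -> nat)
    (x y : multi_index d) :
  pure_tensor (fun i => delta_mx 0 (x i) : 'rV[R[i]]_(d i)) y = (y == x)%:R.
Proof.
rewrite ffunE; have [->|yx] := eqVneq y x.
  by rewrite big1 // => i _; rewrite mxE !eqxx.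
have [i xi] : exists i, y i != x i.
  apply/existsP; apply: contra_neqT yx => /existsPn xy.
  by apply/ffunP => i; apply/eqP/negbNE/xy.
by rewrite (bigD1 i) //= mxE eqxx (negPf xi) mul0r.
Qed.

(** * Functionals on product vectors *)

Lemma functional_eq0 (R : realType) (n : nat) (d : 'I_n -> nat)
    (g : 'Hom(tensor_space R d, R[i]^o)) :
  (forall u, g (pure_tensor u) = 0) -> g = 0.
Proof.
move=> g0; apply/lfunP => v; rewrite lfunE /=.
(* The pure tensors of standard basis vectors already span the space. *)
have -> : v = \sum_x (v x : R[i]) *:
    pure_tensor (fun i => delta_mx 0 (x i) : 'rV[R[i]]_(d i)).
  apply/ffunP => y; rewrite sum_ffunE (bigD1 y) //= big1 ?addr0.
    by rewrite ffunE pure_tensor_delta eqxx [RHS]mulr1.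
  by move=> x xy; rewrite ffunE pure_tensor_delta eq_sym (negPf xy) [LHS]mulr0.
by rewrite linear_sum big1 // => x _; rewrite linearZ /= g0 scaler0.
Qed.

(* The slots of [u] are replaced by those of [v] one after the other. A
   replacement that would kill [f] is avoided by adding the old slot to the new
   one, which multilinearity undoes for [g] afterwards. *)
Lemma functional_eq0_of_zeros (R : realType) (n : nat) (d : 'I_n -> nat)
    (f g : 'Hom(tensor_space R d, R[i]^o))
    (u : forall i : 'I_n, 'rV[R[i]]_(d i)) :
  (forall w, f (pure_tensor w) = 0 -> g (pure_tensor w) = 0) ->
  f (pure_tensor u) != 0 -> g (pure_tensor u) = 0 -> g = 0.
Proof.
move=> fg fu gu; apply: functional_eq0 => v.
have linD (h : 'Hom(tensor_space R d, R[i]^o)) z i (a : R[i])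
    (w w' : 'rV[R[i]]_(d i)) :
    h (pure_tensor (dfwith z (a *: w + w'))) =
    a * h (pure_tensor (dfwith z w)) + h (pure_tensor (dfwith z w')).
  by rewrite pure_tensor_dfwithP linearP.
have dfid z i :
    pure_tensor (dfwith z (z i)) = pure_tensor z :> tensor_space R d.
  by apply: pure_tensor_eq => j; case: dfwithP.
have slot z i w : f (pure_tensor z) != 0 -> g (pure_tensor z) = 0 ->
    g (pure_tensor (dfwith z (w : 'rV[R[i]]_(d i)))) = 0.
  (* [a] makes [f] vanish when slot [i] is [- a *: z i + w]; hence [g] vanishes there, and its term
     at [z] is zero. *)
  move=> fz gz; set a := f (pure_tensor (dfwith z w)) / f (pure_tensor z).
  have := linD f z i (- a) (z i) w; rewrite dfid mulNr divfK // addNr => /fg.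
  by rewrite linD dfid gz mulr0 add0r.
(* Induction on [k]: [u] and [v] may differ only in the first [k] slots. *)
suff ind k : forall u v, f (pure_tensor u) != 0 -> g (pure_tensor u) = 0 ->
    (forall i : 'I_n, (k <= i)%N -> u i = v i) -> g (pure_tensor v) = 0.
  by apply: (ind n u v) => // i; rewrite leqNgt ltn_ord.
elim: k => [|k IHk] {fu gu}u {}v fu gu uv.
  by rewrite -(@pure_tensor_eq _ _ _ u v) // => i; apply: uv.
have [nk|kn] := leqP n k.
  by apply: IHk fu gu _ => i /(leq_trans nk); rewrite leqNgt ltn_ord.
pose i := Ordinal kn.
have agree (w : 'rV[R[i]]_(d i)) (j : 'I_n) :
    (k <= j)%N -> dfwith u w j = dfwith v w j.
  move=> kj; have [<-|ij] := eqVneq i j; first by rewrite !dfwith_in.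
  by rewrite !dfwith_out // uv // ltn_neqAle kj andbT.
have [fv0|fv] := eqVneq (f (pure_tensor (dfwith u (v i)))) 0; last first.
  rewrite -(dfid v i); apply: IHk fv _ _; first exact: slot.
  exact: agree.
(* By [fv0], replacing slot [i] of [u] by [u i + v i] keeps the value of [f]; the factor 1 fits the
   shape of [linD]. *)
have gvu : g (pure_tensor (dfwith v (1 *: u i + v i))) = 0.
  apply: (IHk (dfwith u (1 *: u i + v i))) (agree _); last exact: slot.
  by rewrite linD fv0 addr0 mul1r dfid.
have gvi : g (pure_tensor (dfwith v (u i))) = 0.
  apply: (IHk (dfwith u (u i))) (agree _); last exact: slot.
  by rewrite dfid.
by move: gvu; rewrite linD gvi mulr0 add0r dfid.
Qed.

(** With [c] the ratio of the values at a pure tensor where [f] is nonzero, [g - c *: f] vanishes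
    there and at every pure tensor where [f] does. *)
Lemma functional_proportional (R : realType) (n : nat) (d : 'I_n -> nat)
    (f g : 'Hom(tensor_space R d, R[i]^o)) :
  (forall u, f (pure_tensor u) = 0 -> g (pure_tensor u) = 0) ->
  exists c : R[i], g = c *: f.
Proof.
move=> fg; have [f0|] := pselect (forall u, f (pure_tensor u) = 0).
  by exists 0; rewrite scale0r; apply: functional_eq0 => u; apply/fg/f0.
move=> /existsNP[u /eqP fu]; exists (g (pure_tensor u) / f (pure_tensor u)).
apply/subr0_eq/(@functional_eq0_of_zeros _ _ _ f _ u) => // [w fw|].
  by rewrite add_lfunE opp_lfunE scale_lfunE fw scaler0 subr0 fg.
by rewrite add_lfunE opp_lfunE scale_lfunE [_ *: _]divfK // subrr.
Qed.

(** [L] is the kernel of some [f]. A functional vanishing at all product vectors of [L] is a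
    multiple of [f], so it cannot be nonzero at a vector of [L]. *)
Lemma codim_le1_product_basis (R : realType) (n : nat) (d : 'I_n -> nat)
    (L : {vspace tensor_space R d}) :
  (dim (tensor_space R d) <= (\dim L).+1)%N -> has_product_basis L.
Proof.
move=> /codim_le1_lker[f ->]; apply: basis_of_spanning => U UP.
apply/subvP => v; rewrite memv_ker => /eqP fv; apply/negPn/negP.
move=> /separating_functional[g /subvP Ug /negP]; apply.
have [|c ->] := @functional_proportional _ _ _ f g; last first.
  by rewrite scale_lfunE fv scaler0.
move=> u /eqP fu; apply/eqP; rewrite -memv_ker; apply/Ug/UP.
  by exists u.
by rewrite memv_ker.
Qed.

(** * Dimension count and codimension two *)

Lemma dim_tensor_space (R : realType) (n : nat) (d : 'I_n -> nat) :
  dim (tensor_space R d) = (\prod_(i < n) d i)%N.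
Proof.
rewrite [LHS]muln1 card_dep_ffun foldrE big_map big_enum /=.
by apply: eq_bigr => i _; rewrite card_ord.
Qed.

(** The Boolean [b i] is read as the number 0 or 1, a legal index by [d_ge2]. *)
Definition binary_index (n : nat) (d : 'I_n -> nat)
    (d_ge2 : forall i : 'I_n, (2 <= d i)%N) (b : 'I_n -> bool) :
    multi_index d :=
  [ffun i => Ordinal (leq_trans (leq_b1 (b i) : (b i < 2)%N) (d_ge2 i))].

(** A 2 by 2 minor in slots [i] and [j], the other slots being at 0: in every slot both sides have
    the same two factors. *)
Lemma pure_tensor_minor (R : realType) (n : nat) (d : 'I_n -> nat)
    (d_ge2 : forall i : 'I_n, (2 <= d i)%N) (i j : 'I_n)
    (u : forall i : 'I_n, 'rV[R[i]]_(d i)) : i != j ->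
  let e := binary_index d_ge2 in
  (pure_tensor u (e (pred2 i j)) : R[i]) * pure_tensor u (e pred0) =
  (pure_tensor u (e (pred1 i)) : R[i]) * pure_tensor u (e (pred1 j)).
Proof.
move=> ij e; rewrite !ffunE -!big_split /=; apply: eq_bigr => k _.
rewrite !ffunE; set z := Ordinal _; set z0 := Ordinal _.
set zi := Ordinal _; set zj := Ordinal _.
have [ki|ki] := eqVneq k i.
  have -> : z = zi by apply/val_inj; rewrite /= ki eqxx.
  by have -> : z0 = zj by apply/val_inj; rewrite /= ki (negPf ij).
(* Outside slot [i] the two factors come in the opposite order. *)
rewrite mulrC; have -> : z = zj by apply/val_inj; rewrite /= (negPf ki).
by have -> : z0 = zi by apply/val_inj; rewrite /= (negPf ki).
Qed.

Lemma binary_index_inj (n : nat) (d : 'I_n -> nat)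
    (d_ge2 : forall i : 'I_n, (2 <= d i)%N) (b c : 'I_n -> bool) :
  binary_index d_ge2 b = binary_index d_ge2 c -> b =1 c.
Proof.
move=> /ffunP bc i; move: (bc i); rewrite !ffunE => /(congr1 val) /=.
by case: (b i) (c i) => [] [].
Qed.

Lemma codim2_no_product_basis (R : realType) (n : nat) (d : 'I_n -> nat)
    (n_ge2 : (2 <= n)%N) (d_ge2 : forall i : 'I_n, (2 <= d i)%N) :
  exists L : {vspace tensor_space R d},
    ~ has_product_basis L /\ \dim L = (dim (tensor_space R d) - 2)%N.
Proof.
pose i : 'I_n := Ordinal (ltnW n_ge2); pose j : 'I_n := Ordinal n_ge2.
have ij : i != j by [].
pose e := binary_index d_ge2.
pose p := e (pred2 i j); pose q := e (pred1 i); pose r := e (pred1 j).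
have pq : p != q.
  by apply/eqP => /binary_index_inj/(_ j).
have pr : p != r.
  by apply/eqP => /binary_index_inj/(_ i).
have qr : q != r.
  by apply/eqP => /binary_index_inj/(_ i).
(* The kernel of [h] is the subspace [v_11 = 0], [v_10 = v_01]; surjectivity makes its codimension
   exactly two. *)
pose h (v : tensor_space R d) : (R[i]^o * R[i]^o)%type := (v p, v q - v r).
have h_lin : linear h.
  move=> a v w; rewrite /h !ffunE; congr pair.
  by rewrite /= scalerBr opprD addrACA.
pose f := linfun h; have fE : f =1 h := linear_linfun h_lin.
pose E a b : tensor_space R d :=
  [ffun x => if x == p then a else if x == q then b else 0 : R[i]^o].
have f_onto : limg f = fullv.
  apply/vspaceP => -[a b]; rewrite memvf; apply/memv_imgP.
  exists (E a b); first exact: memvf.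
  rewrite fE /h !ffunE !eqxx (eq_sym q p) (eq_sym r p) (eq_sym r q).
  by rewrite (negPf pq) (negPf pr) (negPf qr) subr0.
exists (lker f); split; last first.
  by rewrite -dimvf -(limg_ker_dim f {:_}) capfv f_onto dimvf addnK.
move=> [s [/andP[/eqP sL _] s_prod]].
(* [w] lies in the kernel but has coordinate 1 at [q]. *)
pose w : tensor_space R d := [ffun x => ((x == q) || (x == r))%:R : R[i]^o].
have wL : w \in lker f.
  rewrite memv_ker fE /h !ffunE !eqxx (negPf pq) (negPf pr) orbT.
  by rewrite subrr.
pose cq (v : tensor_space R d) : R[i]^o := v q.
have cq_lin : linear cq by move=> a u v; rewrite /cq !ffunE.
pose g := linfun cq; have gE : g =1 cq := linear_linfun cq_lin.
(* By the minor, each vector of a product basis has square zero at [q], which would put the whole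
   kernel in [v q = 0]. *)
have : (lker f <= lker g)%VS.
  rewrite -sL; apply/span_subvP => v vs; rewrite memv_ker gE /cq.
  have := memv_span vs; rewrite sL memv_ker fE => /eqP[vp /subr0_eq vqr].
  have [u vu] := s_prod _ vs; have := pure_tensor_minor d_ge2 u ij.
  rewrite /= -vu -/e -/p -/q -/r vp -vqr mul0r => /esym/eqP.
  by rewrite mulf_eq0 orbb.
move=> /subvP/(_ w wL); rewrite memv_ker gE /cq ffunE eqxx /=.
by rewrite oner_eq0.
Qed.

Theorem theorem1p1 (R : realType) (n : nat) (d : 'I_n -> nat)
    (n_ge2 : (2 <= n)%N) (d_ge2 : forall i : 'I_n, (2 <= d i)%N) :
  is_maximum
    (fun k : nat => exists L : {vspace tensor_space R d},
       ~ has_product_basis L /\ \dim L = k)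
    ((\prod_(i < n) d i)%N - 2)%N.
Proof.
rewrite -(dim_tensor_space R); split; first exact: codim2_no_product_basis.
move=> _ [L [nL <-]]; rewrite leqNgt -ltnS; apply/negP => dimL; apply: nL.
apply: codim_le1_product_basis.
(* Subtraction truncates, so 2 is added back through an inequality. *)
apply: (@leq_trans (2 + (dim (tensor_space R d) - 2))) dimL.
by rewrite -leq_subLR.
Qed.
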